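(* Let $x+y=u_3+u_4$, $xy=u_1u_2$, $F(t):=F(x,y,u_4,q;t)$ and $\tilde F(t):=F(x,y,u_3,\tfrac1q;t)$. Then $$\sum_{n\ge0}P_{n+1}(u_1,u_2,u_3,u_4|\alpha,\beta;q)\frac{t^n}{[n]_q!}=\exp\Big(\int_0^t\frac{\ln\big[1-(1-q)z\alpha(u_3+u_2F(zq))\big]^{-1}}{(1-q)z}\,d_qz+\int_0^t\frac{\ln\big[1-(q-1)z\beta(u_4+u_2\tilde F(z))\big]^{-1}}{(1-\frac1q)z}\,d_{\frac1q}z\Big).$$
   Context: $\mathfrak{S}_n$ is the set of permutations of $[n]$. With boundary $\sigma_0=\sigma_{n+1}=0$, $\mathrm{M},\mathrm{V},\mathrm{da},\mathrm{dd}$ count indices $i\in[n]$ that are peaks ($\sigma_{i-1}<\sigma_i>\sigma_{i+1}$), valleys ($\sigma_{i-1}>\sigma_i<\sigma_{i+1}$), double ascents ($\sigma_{i-1}<\sigma_i<\sigma_{i+1}$), double descents ($\sigma_{i-1}>\sigma_i>\sigma_{i+1}$). $\mathrm{lma},\mathrm{rma}$ count left-to-right and right-to-left maxima, $\mathrm{inv}$ counts inversions. $P_n(u_1,u_2,u_3,u_4|\alpha,\beta;q):=\sum_{\sigma\in\mathfrak{S}_n}u_1^{\mathrm{V}(\sigma)}u_2^{\mathrm{M}(\sigma)-1}u_3^{\mathrm{da}(\sigma)}u_4^{\mathrm{dd}(\sigma)}\alpha^{\mathrm{lma}(\sigma)-1}\beta^{\mathrm{rma}(\sigma)-1}q^{\mathrm{inv}(\sigma)}$.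 $[n]_q!=\prod_{i=1}^n(1+q+\cdots+q^{i-1})$, $\exp_q(t)=\sum_{n\ge0}t^n/[n]_q!$, and $F(x,y,u,q;t):=u_1\frac{\exp_q((x-u)t)-\exp_q((y-u)t)}{x\exp_q((y-u)t)-y\exp_q((x-u)t)}$. The $q$-integral is $\int_0^t f(z)\,d_qz:=t(1-q)\sum_{n\ge0}f(q^nt)q^n$ (and $d_{1/q}$ is the same with $q$ replaced by $1/q$). *)

(* Defs.v *)
From HB Require Import structures.
From mathcomp Require Import all_boot all_order all_fingroup all_algebra.
From mathcomp Require Import boolp.

Set Implicit Arguments.
Unset Strict Implicit.
Unset Printing Implicit Defensive.

Import GRing.Theory.
Local Open Scope ring_scope.

(* Formal power series in one variable; functional extensionality and choice
   (boolp) make them a commutative unit ring with Leibniz equality. *)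
Record fps (K : Type) := FPS { coefs : nat -> K }.

Lemma fpsP (K : Type) (f g : fps K) : coefs f =1 coefs g <-> f = g.
Proof. by case: f g => [f] [g] /=; split=> [/funext->|[->]]. Qed.

HB.instance Definition _ (K : Type) := gen_eqMixin (fps K).
HB.instance Definition _ (K : Type) := gen_choiceMixin (fps K).

Section FpsRing.
Variable K : fieldType.
Implicit Types f g h : fps K.

Definition fps_zero : fps K := FPS (fun _ => 0).
Definition fps_opp f : fps K := FPS (fun n => - coefs f n).
Definition fps_add f g : fps K := FPS (fun n => coefs f n + coefs g n).
Definition fps_one : fps K := FPS (fun n => (n == 0)%:R).
Definition fps_mul f g : fps K :=
  FPS (fun n => \sum_(i < n.+1) coefs f i * coefs g (n - i)%N).

Fact fps_addA : associative fps_add.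
Proof. by move=> f g h; apply/fpsP => n /=; rewrite addrA. Qed.
Fact fps_addC : commutative fps_add.
Proof. by move=> f g; apply/fpsP => n /=; rewrite addrC. Qed.
Fact fps_add0 : left_id fps_zero fps_add.
Proof. by move=> f; apply/fpsP => n /=; rewrite add0r. Qed.
Fact fps_addN : left_inverse fps_zero fps_opp fps_add.
Proof. by move=> f; apply/fpsP => n /=; rewrite addNr. Qed.

HB.instance Definition _ :=
  GRing.isZmodule.Build (fps K) fps_addA fps_addC fps_add0 fps_addN.

(* The ring laws are transported from {poly K} through truncation. *)
Let trunc N f : {poly K} := \poly_(i < N) coefs f i.

Let coefs_mul_trunc N f g n : (n < N)%N ->
  coefs (fps_mul f g) n = (trunc N f * trunc N g)`_n.
Proof.
move=> ltnN; rewrite coefM /=; apply: eq_bigr => i _.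
have ltiN : (i < N)%N by apply: leq_ltn_trans ltnN; rewrite -ltnS.
by rewrite !coef_poly ltiN (leq_ltn_trans (leq_subr i n) ltnN).
Qed.

Let coef_mul_eq (p p' r r' : {poly K}) n :
    (forall i, (i <= n)%N -> p`_i = p'`_i) ->
    (forall i, (i <= n)%N -> r`_i = r'`_i) ->
  (p * r)`_n = (p' * r')`_n.
Proof.
move=> Ep Er; rewrite !coefM; apply: eq_bigr => i _.
by rewrite Ep ?Er ?leq_subr // -ltnS.
Qed.

Let trunc_mul N f g i : (i < N)%N ->
  (trunc N (fps_mul f g))`_i = (trunc N f * trunc N g)`_i.
Proof. by move=> ltiN; rewrite coef_poly ltiN; apply: coefs_mul_trunc. Qed.

Fact fps_mulA : associative fps_mul.
Proof.
move=> f g h; apply/fpsP => n; rewrite !(@coefs_mul_trunc n.+1) //.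
transitivity (trunc n.+1 f * (trunc n.+1 g * trunc n.+1 h))`_n.
  by apply: coef_mul_eq => // i lein; rewrite trunc_mul.
by rewrite mulrA; apply: coef_mul_eq => // i lein; rewrite trunc_mul.
Qed.

Fact fps_mulC : commutative fps_mul.
Proof.
by move=> f g; apply/fpsP => n; rewrite !(@coefs_mul_trunc n.+1) // mulrC.
Qed.

Fact fps_mul1 : left_id fps_one fps_mul.
Proof.
move=> f; apply/fpsP => n /=; rewrite big_ord_recl /= mul1r subn0.
by rewrite big1 ?addr0 // => i _; rewrite mul0r.
Qed.

Fact fps_mulDl : left_distributive fps_mul +%R.
Proof.
move=> f g h; apply/fpsP => n /=; rewrite -big_split /=.
by apply: eq_bigr => i _; rewrite mulrDl.
Qed.

Fact fps_oner_neq0 : fps_one != 0.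
Proof. by apply/eqP => /fpsP/(_ 0)/eqP; rewrite /= oner_eq0. Qed.

HB.instance Definition _ := GRing.Zmodule_isComNzRing.Build (fps K)
  fps_mulA fps_mulC fps_mul1 fps_mulDl fps_oner_neq0.

Definition fps_scale (a : K) f : fps K := FPS (fun n => a * coefs f n).

Fact fps_scaleA a b f : fps_scale a (fps_scale b f) = fps_scale (a * b) f.
Proof. by apply/fpsP => n /=; rewrite mulrA. Qed.
Fact fps_scale1 : left_id 1 fps_scale.
Proof. by move=> f; apply/fpsP => n /=; rewrite mul1r. Qed.
Fact fps_scaleDr : right_distributive fps_scale +%R.
Proof. by move=> a f g; apply/fpsP => n /=; rewrite mulrDr. Qed.
Fact fps_scaleDl f : {morph fps_scale^~ f : a b / a + b}.
Proof. by move=> a b; apply/fpsP => n /=; rewrite mulrDl. Qed.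

HB.instance Definition _ := GRing.Zmodule_isLmodule.Build K (fps K)
  fps_scaleA fps_scale1 fps_scaleDr fps_scaleDl.

Fact fps_scaleAl (a : K) f g : a *: (f * g) = (a *: f) * g.
Proof.
apply/fpsP => n /=; rewrite mulr_sumr.
by apply: eq_bigr => i _; rewrite mulrA.
Qed.

HB.instance Definition _ := GRing.Lmodule_isLalgebra.Build K (fps K) fps_scaleAl.

Lemma coefs0 n : coefs (0 : fps K) n = 0. Proof. by []. Qed.
Lemma coefs1 n : coefs (1 : fps K) n = (n == 0)%:R. Proof. by []. Qed.
Lemma coefsD f g n : coefs (f + g) n = coefs f n + coefs g n.
Proof. by []. Qed.
Lemma coefsN f n : coefs (- f) n = - coefs f n. Proof. by []. Qed.
Lemma coefsB f g n : coefs (f - g) n = coefs f n - coefs g n.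
Proof. by []. Qed.
Lemma coefsZ a f n : coefs (a *: f) n = a * coefs f n. Proof. by []. Qed.
Lemma coefsM f g n :
  coefs (f * g) n = \sum_(i < n.+1) coefs f i * coefs g (n - i)%N.
Proof. by []. Qed.
Lemma coefs_sum I (r : seq I) (P : pred I) (F : I -> fps K) n :
  coefs (\sum_(i <- r | P i) F i) n = \sum_(i <- r | P i) coefs (F i) n.
Proof. exact: (big_morph (fun f => coefs f n) (fun f g => coefsD f g n)). Qed.

Lemma coefsX_small f k n : coefs f 0 = 0 -> (n < k)%N -> coefs (f ^+ k) n = 0.
Proof.
move=> f0; elim: k n => // k IHk n ltnk; rewrite exprS coefsM big1 // => i _.
case: i => [[|i] /= ltin]; first by rewrite f0 mul0r.
have ltnik : (n - i.+1 < k)%N.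
  rewrite -ltnS; apply: leq_trans ltnk.
  by rewrite ltnS ltn_subrL /=; apply: leq_ltn_trans (leq0n i) _.
by rewrite IHk ?mulr0.
Qed.

(* c(f(z)); meaningful when f has zero constant term. *)
Definition fps_comp (c f : fps K) : fps K :=
  FPS (fun n => \sum_(k < n.+1) coefs c k * coefs (f ^+ k) n).

(* f is invertible iff f(0) != 0, and then its inverse is
   f(0)^-1 * sum_k (1 - f / f(0))^k. *)
Definition fps_unit : pred (fps K) := fun f => coefs f 0 != 0.
Definition fps_inv f : fps K :=
  if coefs f 0 == 0 then f
  else (coefs f 0)^-1 *: fps_comp (FPS (fun _ => 1)) (1 - (coefs f 0)^-1 *: f).

Let mul_geom f n : coefs f 0 = 0 ->
  coefs ((1 - f) * fps_comp (FPS (fun _ => 1)) f) n = (n == 0)%:R.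
Proof.
move=> f0.
have E m : (m <= n)%N -> coefs (fps_comp (FPS (fun _ => 1)) f) m
    = coefs (\sum_(k < n.+1) f ^+ k) m.
  move=> lemn; rewrite coefs_sum /=.
  rewrite [RHS](bigID (fun k : 'I_n.+1 => k < m.+1)%N) /=.
  rewrite [X in _ + X]big1 ?addr0; last first.
    by move=> k; rewrite -leqNgt => ltmk; rewrite coefsX_small.
  rewrite (big_ord_widen n.+1 (fun k => 1 * coefs (f ^+ k) m)) //.
  by apply: eq_bigr => k _; rewrite mul1r.
transitivity (coefs ((1 - f) * \sum_(k < n.+1) f ^+ k) n).
  by rewrite !coefsM; apply: eq_bigr => i _; rewrite E ?leq_subr.
have -> : (1 - f) * (\sum_(k < n.+1) f ^+ k) = 1 - f ^+ n.+1.
  by rewrite -{2}(expr1n _ n.+1) subrXX; congr (_ * _); apply: eq_bigr => k _;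
    rewrite expr1n mul1r.
by rewrite coefsB coefsX_small // subr0.
Qed.

Fact fps_mulVr : {in fps_unit, left_inverse 1 fps_inv *%R}.
Proof.
move=> f; rewrite unfold_in => f0; rewrite /fps_inv (negPf f0) mulrC.
set a := coefs f 0 in f0 *; set w := 1 - a^-1 *: f.
have -> : f = a *: (1 - w) by rewrite /w opprB addrC subrK scalerA divff ?scale1r.
rewrite -fps_scaleAl mulrC -fps_scaleAl scalerA divff // scale1r mulrC.
apply/fpsP => n; rewrite mul_geom ?coefs1 // /w coefsB coefsZ.
by rewrite mulVf ?subrr.
Qed.

Fact fps_unitPl f g : g * f = 1 -> fps_unit f.
Proof.
move=> /fpsP/(_ 0); rewrite coefsM big_ord1 coefs1 /= /fps_unit => E.
by apply: contra_eq_neq E => ->; rewrite mulr0 eq_sym oner_neq0.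
Qed.

Fact fps_invr_out : {in [predC fps_unit], fps_inv =1 id}.
Proof.
by move=> f; rewrite inE /= unfold_in negbK /fps_inv => ->.
Qed.

HB.instance Definition _ := GRing.ComNzRing_hasMulInverse.Build (fps K)
  fps_mulVr fps_unitPl fps_invr_out.

Definition fps_z : fps K := FPS (fun n => (n == 1)%:R).

Lemma coefs_zM f n :
  coefs (fps_z * f) n = if n is m.+1 then coefs f m else 0.
Proof.
rewrite coefsM; case: n => [|n]; first by rewrite big_ord1 mul0r.
rewrite 2!big_ord_recl [X in _ + (_ + X)]big1 => [|i _]; last exact: mul0r.
by rewrite addr0 /= mul0r add0r mul1r subSS subn0.
Qed.

(* f(z) / z; meaningful when f has zero constant term. *)
Definition fps_divz f : fps K := FPS (fun n => coefs f n.+1).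

(* f(a z) *)
Definition fps_dil (a : K) f : fps K := FPS (fun n => a ^+ n * coefs f n).

Definition fps_exp f : fps K := fps_comp (FPS (fun k => k`!%:R^-1)) f.

(* ln g = sum_(k >= 1) (-1)^(k+1) (g - 1)^k / k, for g with constant term 1;
   the k = 0 coefficient below vanishes since 0^-1 = 0. *)
Definition fps_ln g : fps K :=
  fps_comp (FPS (fun k => (-1) ^+ k.+1 / k%:R)) (g - 1).

Definition qfact (q : K) n : K := \prod_(1 <= i < n.+1) \sum_(j < i) q ^+ j.

Definition qexp (q : K) : fps K := FPS (fun n => (qfact q n)^-1).

(* The integral t (1 - q) sum_(n >= 0) f(q^n t) q^n, computed coefficientwise:
   the coefficient of t^(k+1) is (1 - q) f_k sum_n (q^(k+1))^n, where the
   geometric series has sum 1 / (1 - q^(k+1)) as a rational function of q.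
   Only this reading allows q and 1/q to be used in the same formula. *)
Definition qint (q : K) f : fps K :=
  FPS (fun n => if n is k.+1 then (1 - q) * coefs f k / (1 - q ^+ k.+1) else 0).

(* The first N terms of the defining series sum up to qint q f, minus its
   dilation by q^N, whose coefficients tend to 0 whenever q^N does. *)
Lemma qint_partial_sum (q : K) f N :
    (forall n, (0 < n)%N -> q ^+ n != 1) ->
  fps_z * ((1 - q) *: \sum_(n < N) q ^+ n *: fps_dil (q ^+ n) f)
  = qint q f - fps_dil (q ^+ N) (qint q f).
Proof.
move=> hq; apply/fpsP => -[|k].
  by rewrite coefs_zM coefsB /= mulr0 subr0.
have nz : 1 - q ^+ k.+1 != 0 by rewrite subr_eq0 eq_sym hq.
rewrite coefs_zM coefsB coefsZ coefs_sum /=.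
have -> : \sum_(i < N) coefs (q ^+ i *: fps_dil (q ^+ i) f) k
   = (\sum_(i < N) (q ^+ k.+1) ^+ i) * coefs f k.
  rewrite mulr_suml; apply: eq_bigr => i _.
  by rewrite coefsZ /= mulrA -exprS -!exprM mulnC.
set c := _ / _; rewrite -{1}(mul1r c) -mulrBl.
have -> : 1 - (q ^+ N) ^+ k.+1 = (1 - q ^+ k.+1) * \sum_(i < N) (q ^+ k.+1) ^+ i.
  rewrite -exprM mulnC exprM -{1}(expr1n K N) subrXX; congr (_ * _).
  by apply: eq_bigr => i _; rewrite expr1n mul1r.
by rewrite [RHS]mulrC [RHS]mulrA mulfVK // -mulrA (mulrC (coefs f k)).
Qed.

(* u1 (exp_q((x-u)t) - exp_q((y-u)t)) / (x exp_q((y-u)t) - y exp_q((x-u)t));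
   the denominator has constant term x - y, hence is a unit iff x != y. *)
Definition Fser (u1 x y u q : K) : fps K :=
  let ex := fps_dil (x - u) (qexp q) in
  let ey := fps_dil (y - u) (qexp q) in
  u1 *: ((ex - ey) / (x *: ey - y *: ex)).

End FpsRing.

Arguments fps_z {K}.

Section Stats.
Variable n : nat.
Implicit Type s : 'S_n.

(* sigma_k for 0 <= k <= n+1, with values in {1..n} on [n] and
   sigma_0 = sigma_(n+1) = 0; index i : 'I_n stands for position i.+1. *)
Definition letter s (k : nat) : nat :=
  if k is k'.+1 then oapp (fun i : 'I_n => (s i).+1) 0%N (insub k') else 0%N.

Definition peaks s : nat :=
  #|[set i : 'I_n | (letter s i < letter s i.+1)%N
                    && (letter s i.+1 > letter s i.+2)%N]|.
Definition valleys s : nat :=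
  #|[set i : 'I_n | (letter s i > letter s i.+1)%N
                    && (letter s i.+1 < letter s i.+2)%N]|.
Definition dasc s : nat :=
  #|[set i : 'I_n | (letter s i < letter s i.+1)%N
                    && (letter s i.+1 < letter s i.+2)%N]|.
Definition ddes s : nat :=
  #|[set i : 'I_n | (letter s i > letter s i.+1)%N
                    && (letter s i.+1 > letter s i.+2)%N]|.
Definition lma s : nat :=
  #|[set i : 'I_n | [forall j : 'I_n, (j < i)%N ==> (s j < s i)%N]]|.
Definition rma s : nat :=
  #|[set i : 'I_n | [forall j : 'I_n, (i < j)%N ==> (s j < s i)%N]]|.
Definition inv s : nat :=
  #|[set p : 'I_n * 'I_n | (p.1 < p.2)%N && (s p.1 > s p.2)%N]|.

End Stats.

(* For n > 0 the statistics peaks, lma and rma are positive, so that the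
   predecessors below are exact. *)
Definition Ppoly (K : fieldType) (n : nat) (u1 u2 u3 u4 a b q : K) : K :=
  \sum_(s : 'S_n) u1 ^+ valleys s * u2 ^+ (peaks s).-1
                  * u3 ^+ dasc s * u4 ^+ ddes s
                  * a ^+ (lma s).-1 * b ^+ (rma s).-1 * q ^+ inv s.

(* Main.v *)
Require Import Defs.
From mathcomp Require Import all_boot all_order all_fingroup all_algebra.
From mathcomp Require Import ring zify.

(* Remove the maximal letter m of a word sigma = w1 m w2: inv splits as
   inv w1 + inv w2 + |w2| + cross(w1, w2), where the cross inversions sum up to
   a Gaussian binomial, and w1, w2 are independent words in which m plays the
   role of an infinite boundary letter.  Hence the generating function of the
   permutations is A(t) B(t), where A(t), B(t/q) and F(t) enumerate the words
   with boundaries (0, oo), (oo, 0) and (oo, oo), and the same decomposition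
   gives the q-difference equations
     F(t) - F(qt) = (1-q) t (u1 + u3 F(t) + u4 F(qt) + u2 F(t) F(qt)),
     A(qt) = A(t) (1 - (1-q) t alpha (u3 + u2 F(qt))),
     B(t/q) = B(t) (1 - (q-1) t beta (u4 + u2 F(t))).
   The first is solved by the stated quotient of q-exponentials, and taking
   logarithms solves the others by q-integrals.  Finally F~ = F because
   x - u3 = -(y - u4) and exp_q(t) exp_(1/q)(-t) = 1. *)

Set Implicit Arguments.
Unset Strict Implicit.
Unset Printing Implicit Defensive.

Import GRing.Theory.
Local Open Scope ring_scope.

(** * Formal power series *)

Section Dilation.
Variable K : fieldType.
Implicit Types (a b c : K) (f g h : fps K).

Lemma coefs_dil a f n : coefs (fps_dil a f) n = a ^+ n * coefs f n.
Proof. by []. Qed.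

Lemma fps_dilD a f g : fps_dil a (f + g) = fps_dil a f + fps_dil a g.
Proof. by apply/fpsP => n; rewrite /= mulrDr. Qed.
Lemma fps_dilN a f : fps_dil a (- f) = - fps_dil a f.
Proof. by apply/fpsP => n; rewrite /= mulrN. Qed.
Lemma fps_dilZ a c f : fps_dil a (c *: f) = c *: fps_dil a f.
Proof. by apply/fpsP => n; rewrite /= mulrCA. Qed.
Lemma fps_dil1 a : fps_dil a 1 = 1 :> fps K.
Proof. by apply/fpsP => -[|n]; rewrite /= ?mulr0 // mulr1. Qed.
Lemma fps_dilM a f g : fps_dil a (f * g) = fps_dil a f * fps_dil a g.
Proof.
apply/fpsP => n; rewrite coefs_dil !coefsM mulr_sumr; apply: eq_bigr => i _.
by rewrite !coefs_dil mulrACA -exprD subnKC // -ltnS.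
Qed.
Lemma fps_dilX a f k : fps_dil a (f ^+ k) = fps_dil a f ^+ k.
Proof. by elim: k => [|k IHk]; rewrite ?fps_dil1 // !exprS fps_dilM IHk. Qed.
Lemma fps_dil_z a : fps_dil a fps_z = a *: fps_z.
Proof. by apply/fpsP => -[|[|n]]; rewrite /= ?mulr0 ?expr1. Qed.
Lemma fps_dil_dil a b f : fps_dil a (fps_dil b f) = fps_dil (a * b) f.
Proof. by apply/fpsP => n; rewrite /= mulrA exprMn. Qed.
Lemma fps_dil_id f : fps_dil 1 f = f.
Proof. by apply/fpsP => n; rewrite /= expr1n mul1r. Qed.

Lemma fps_unitE f : (f \is a GRing.unit) = (coefs f 0 != 0).
Proof. by []. Qed.

Lemma fps_dil_unit a f : (fps_dil a f \is a GRing.unit) = (f \is a GRing.unit).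
Proof. by rewrite !fps_unitE /= mul1r. Qed.

Lemma coefs0M f g : coefs (f * g) 0 = coefs f 0 * coefs g 0.
Proof. by rewrite coefsM big_ord1. Qed.

Lemma fps_comp_dil (c : fps K) f a :
  fps_comp c (fps_dil a f) = fps_dil a (fps_comp c f).
Proof.
apply/fpsP => n /=; rewrite mulr_sumr; apply: eq_bigr => k _.
by rewrite -fps_dilX /= mulrCA.
Qed.

Lemma coefs0_comp (c : fps K) f : coefs (fps_comp c f) 0 = coefs c 0.
Proof. by rewrite /= big_ord1 expr0 mulr1. Qed.

Definition fps_deriv f : fps K := FPS (fun n => n.+1%:R * coefs f n.+1).

Lemma coefs_deriv f n : coefs (fps_deriv f) n = n.+1%:R * coefs f n.+1.
Proof. by []. Qed.

Lemma fps_derivD f g : fps_deriv (f + g) = fps_deriv f + fps_deriv g.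
Proof. by apply/fpsP => n; rewrite /= mulrDr. Qed.

Lemma fps_derivM f g :
  fps_deriv (f * g) = fps_deriv f * g + f * fps_deriv g.
Proof.
apply/fpsP => n; rewrite coefsD coefs_deriv [in LHS]coefsM mulr_sumr.
have -> : \sum_(i < n.+2) n.+1%:R * (coefs f i * coefs g (n.+1 - i)%N) =
  \sum_(i < n.+2) i%:R * coefs f i * coefs g (n.+1 - i)%N +
  \sum_(i < n.+2) coefs f i * ((n.+1 - i)%:R * coefs g (n.+1 - i)%N).
  rewrite -big_split /=; apply: eq_bigr => i _.
  have {1}-> : n.+1 = (i + (n.+1 - i))%N by rewrite subnKC // -ltnS.
  by rewrite natrD; ring.
congr (_ + _).
  by rewrite coefsM big_ord_recl /= !mul0r add0r; apply: eq_bigr => i _ /=.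
rewrite coefsM big_ord_recr /= subnn mul0r mulr0 addr0.
by apply: eq_bigr => i _ /=; rewrite subSn // -ltnS.
Qed.

Lemma fps_scaleAr a f g : f * (a *: g) = a *: (f * g).
Proof. by rewrite mulrC -scalerAl mulrC. Qed.

Lemma fps_derivX f k : fps_deriv (f ^+ k.+1) = k.+1%:R *: (f ^+ k * fps_deriv f).
Proof.
elim: k => [|k IHk]; first by rewrite expr1 expr0 mul1r scale1r.
rewrite exprS fps_derivM IHk fps_scaleAr mulrA -exprS (mulrC _ (f ^+ _)).
by rewrite [in RHS]mulrS scalerDl scale1r.
Qed.

(** The two sides truncate the sum over powers of [f] at different degrees. Since [f] has no
    constant term, [f ^+ k] has no coefficient below degree [k], so the surplus terms vanish. *)
Lemma fps_deriv_comp (c : fps K) f : coefs f 0 = 0 ->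
  fps_deriv (fps_comp c f) = fps_comp (fps_deriv c) f * fps_deriv f.
Proof.
move=> f0; apply/fpsP => n.
transitivity (\sum_(k < n.+1)
    coefs (fps_deriv c) k * coefs (f ^+ k * fps_deriv f) n).
  rewrite /= big_ord_recl expr0 coefs1 mulr0 add0r mulr_sumr.
  apply: eq_bigr => k _; rewrite lift0 mulrCA.
  have -> : n.+1%:R * coefs (f ^+ k.+1) n.+1 = coefs (fps_deriv (f ^+ k.+1)) n.
    by [].
  by rewrite fps_derivX /= mulrA [coefs c _ * _]mulrC.
under eq_bigr => k _ do rewrite coefsM mulr_sumr.
rewrite exchange_big coefsM /=; apply: eq_bigr => i _.
rewrite mulr_suml (big_ord_widen n.+1 (fun k : nat =>
  k.+1%:R * coefs c k.+1 * coefs (f ^+ k) i * ((n - i).+1%:R * coefs f (n - i).+1))) //.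
rewrite [RHS]big_mkcond; apply: eq_bigr => k _.
case: ifPn => [_|]; first by rewrite mulrA.
by rewrite -leqNgt => ltik; rewrite coefsX_small // mul0r mulr0.
Qed.

Hypothesis charK0 : [pchar K] =i pred0.

Let natr_neq0 n : n.+1%:R != 0 :> K.
Proof. by have /pcharf0P-> := charK0. Qed.

(** In characteristic zero the equation determines coefficient [n.+1] from the earlier ones.
    Identities between exponentials then follow without double sums. *)
Lemma fps_ode_unique h f g :
    fps_deriv f = fps_deriv h * f -> fps_deriv g = fps_deriv h * g ->
    coefs f 0 = coefs g 0 -> f = g.
Proof.
move=> Df Dg E0; apply/fpsP => n.
elim/ltn_ind: n => -[|n] IH //; apply: (mulfI (natr_neq0 n)).
have -> : n.+1%:R * coefs f n.+1 = coefs (fps_deriv f) n by [].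
have -> : n.+1%:R * coefs g n.+1 = coefs (fps_deriv g) n by [].
rewrite Df Dg !coefsM; apply: eq_bigr => i _.
by rewrite IH // ltnS leq_subr.
Qed.

Lemma fps_deriv_exp f : coefs f 0 = 0 ->
  fps_deriv (fps_exp f) = fps_deriv f * fps_exp f.
Proof.
move=> f0; rewrite /fps_exp fps_deriv_comp // mulrC; congr (_ * fps_comp _ _).
apply/fpsP => n /=; rewrite factS natrM invfM mulrA mulfV ?mul1r //.
Qed.

Lemma coefs0_exp f : coefs (fps_exp f) 0 = 1.
Proof. by rewrite coefs0_comp /= invr1. Qed.

Lemma fps_expD f g : coefs f 0 = 0 -> coefs g 0 = 0 ->
  fps_exp (f + g) = fps_exp f * fps_exp g.
Proof.
move=> f0 g0; apply: (@fps_ode_unique (f + g)).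
- by rewrite fps_deriv_exp // coefsD f0 g0 addr0.
- by rewrite fps_derivM !fps_deriv_exp // fps_derivD; ring.
- by rewrite coefs0M !coefs0_exp mulr1.
Qed.

(** Moves the sign from the argument [1 - f] of the geometric series into its coefficients, so that
    the inverse is a series in [f - 1], as the logarithm is. *)
Lemma fps_geom f : coefs f 0 = 1 ->
  f^-1 = fps_comp (FPS (fun k => (-1) ^+ k)) (f - 1).
Proof.
move=> f0; have -> : f^-1 = fps_inv f by [].
rewrite /fps_inv f0 oner_eq0 invr1 !scale1r.
apply/fpsP => n; apply: eq_bigr => k _.
rewrite -opprB exprNn; set c := coefs (FPS _) k; rewrite (_ : c = 1) // mul1r.
have -> : (-1) ^+ k = ((-1) ^+ k)%:A :> fps K.
  by elim: (k : nat) => [|m IHm]; rewrite ?scale1r // !exprS IHm !mulN1r scaleNr.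
by rewrite -scalerAl mul1r.
Qed.

Lemma coefs0_ln f : coefs (fps_ln f) 0 = 0.
Proof. by rewrite coefs0_comp /= invr0 mulr0. Qed.

Lemma fps_exp_ln f : coefs f 0 = 1 -> fps_exp (fps_ln f) = f.
Proof.
move=> f0; have f10 : coefs (f - 1) 0 = 0 by rewrite coefsB f0 subrr.
have Uf : f \is a GRing.unit by rewrite fps_unitE f0 oner_eq0.
(* Differentiating the logarithm's coefficients gives the geometric series of ratio -1, which is
   [f^-1] by [fps_geom]. *)
have Dln : fps_deriv (fps_ln f) = f^-1 * fps_deriv f.
  rewrite /fps_ln fps_deriv_comp // fps_geom //; congr (fps_comp _ _ * _).
    apply/fpsP => n /=.
    by rewrite mulrCA mulfV // mulr1 !exprS !mulN1r opprK.
  by apply/fpsP => n; rewrite /= subr0.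
apply: (@fps_ode_unique (fps_ln f)).
- by rewrite fps_deriv_exp // coefs0_ln.
- by rewrite Dln mulrAC mulVr // mul1r.
- by rewrite coefs0_exp.
Qed.

(** The q-integral [h] of [g] satisfies [h(t) - h(qt) = (1-q) t g(t)]. For this integrand the right
    side is [ln f^-1], and exponentiating turns the difference into a product. *)
Lemma exp_qint_ln (q : K) f : (forall n : nat, (0 < n)%N -> q ^+ n != 1) ->
    coefs f 0 = 1 ->
  fps_dil q (fps_exp (qint q ((1 - q)^-1 *: fps_divz (fps_ln f^-1))))
  = fps_exp (qint q ((1 - q)^-1 *: fps_divz (fps_ln f^-1))) * f.
Proof.
move=> q_n1 f0; set h := qint _ _.
have Uf : f \is a GRing.unit by rewrite fps_unitE f0 oner_eq0.
have q1 : 1 - q != 0 by rewrite subr_eq0 eq_sym -[q]expr1 q_n1.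
have Eh : h = fps_dil q h + fps_ln f^-1.
  apply/fpsP => -[|n]; rewrite coefsD; first by rewrite coefs0_ln /= mulr0 addr0.
  have qn1 : 1 - q ^+ n.+1 != 0 by rewrite subr_eq0 eq_sym q_n1.
  rewrite [LHS]/= [coefs (fps_dil _ _) _]/= mulrA [_ * (1 - q)^-1]mulfV // mul1r.
  by rewrite [coefs (fps_ln _) _]/= -/(fps_ln _); field.
have iv0 : coefs f^-1 0 = 1.
  have /fpsP/(_ 0) := mulVr Uf.
  by rewrite coefs0M f0 mulr1 coefs1.
rewrite [in RHS]Eh fps_expD ?coefs0_ln //; last by rewrite /= mulr0.
by rewrite fps_exp_ln // /fps_exp fps_comp_dil mulrVK.
Qed.

End Dilation.

(** * q-exponentials *)

Section QSeries.
Variables (K : fieldType) (q : K).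
Hypothesis q_not_root1 : forall n : nat, (0 < n)%N -> q ^+ n != 1.
Implicit Types (a b c : K) (f g h : fps K).

(** Turns scalings into products of series, which [ring] can handle. *)
Lemma fps_scaleE a f : a *: f = GRing.in_alg (fps K) a * f.
Proof. by rewrite mulr_algl. Qed.

Lemma subr1X_neq0 n : 1 - q ^+ n.+1 != 0.
Proof. by rewrite subr_eq0 eq_sym q_not_root1. Qed.

Lemma subr1q_neq0 : 1 - q != 0.
Proof. exact: (subr1X_neq0 0). Qed.

Lemma invq_not_root1 n : (0 < n)%N -> q^-1 ^+ n != 1.
Proof. by move=> n_gt0; rewrite exprVn invr_eq1 q_not_root1. Qed.

Lemma qint_geom n : (1 - q) * \sum_(j < n) q ^+ j = 1 - q ^+ n.
Proof.
rewrite -{2}(expr1n K n) subrXX; congr (_ * _).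
by apply: eq_bigr => i _; rewrite expr1n mul1r.
Qed.

Lemma qfact0 : qfact q 0 = 1.
Proof. by rewrite /qfact big_geq. Qed.

Lemma qfactS n : (1 - q) * qfact q n.+1 = (1 - q ^+ n.+1) * qfact q n.
Proof. by rewrite /qfact big_nat_recr //= mulrCA qint_geom mulrC. Qed.

Lemma qfact_neq0 n : qfact q n != 0.
Proof.
elim: n => [|n IHn]; first by rewrite qfact0 oner_eq0.
have: (1 - q ^+ n.+1) * qfact q n != 0 by rewrite mulf_neq0 ?subr1X_neq0.
by rewrite -qfactS mulf_eq0 negb_or => /andP[].
Qed.

(** The q-analogue of the differential equation of the exponential; coefficientwise it is the
    recursion [qfactS]. *)
Lemma qexp_dil c :
  fps_dil q (fps_dil c (qexp q))
  = fps_dil c (qexp q) * (1 - ((1 - q) * c) *: fps_z).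
Proof.
rewrite mulrBr mulr1 fps_scaleAr [_ * fps_z]mulrC; apply/fpsP => -[|n].
  by rewrite coefsB coefsZ coefs_zM mulr0 subr0 /= mul1r.
rewrite coefsB coefsZ coefs_zM /=.
have qS : (qfact q n)^-1 = (1 - q ^+ n.+1) / (1 - q) / qfact q n.+1.
  apply: (mulIf (qfact_neq0 n)); rewrite mulVf ?qfact_neq0 // mulrAC -mulrA.
  apply: (mulIf (qfact_neq0 n.+1)); rewrite mul1r.
  apply: (mulfI subr1q_neq0); rewrite qfactS.
  by field; rewrite qfact_neq0 subr1q_neq0.
rewrite qS (exprS c n); field.
by rewrite qfact_neq0 subr1q_neq0.
Qed.

(** Invariance multiplies the coefficient of degree [n] by [q ^+ n], which differs from 1 for
    positive [n], so that coefficient is zero. *)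
Lemma fps_dil_fixed f : fps_dil q f = f -> coefs f 0 = 1 -> f = 1.
Proof.
move=> qf f0; apply/fpsP => -[|n] //; rewrite coefs1 /=.
apply: (mulfI (subr1X_neq0 n)); rewrite mulr0 mulrBl mul1r.
by rewrite -coefs_dil qf subrr.
Qed.

Lemma coefs0_qexp r c : coefs (fps_dil c (qexp r)) 0 = 1 :> K.
Proof. by rewrite /= mul1r /qfact big_geq // invr1. Qed.
End QSeries.

(** With [e'] and [f'] the inverses of [f] and [e], both [e' - f'] and [X * f' - Y * e'] are the
    unprimed expressions divided by [e * f], so the quotient is unchanged. This is that fact without
    denominators. *)
Lemma swap_inv_identity (R : comNzRingType) (X Y e f e' f' : R) :
  f * e' = 1 -> e * f' = 1 ->
  (e' - f') * (X * f - Y * e) = (e - f) * (X * f' - Y * e').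
Proof.
move=> fe' ef'.
transitivity (X * (f * e') + Y * (e * f') - Y * e * e' - X * f * f'); first by ring.
rewrite fe' ef'.
transitivity (X * (e * f') + Y * (f * e') - Y * e * e' - X * f * f'); last by ring.
by rewrite fe' ef'.
Qed.

(** The equation of [Fser] cleared of its denominators [d] and [d']: [s] stands for [(1-q) z], the
    primed letters for the dilated exponentials given by [qexp_dil], and [X + Y - U] for [u3]. *)
Lemma riccati_identity (R : comNzRingType) (X Y U s e f : R) :
  let e' := e * (1 - s * (X - U)) in let f' := f * (1 - s * (Y - U)) in
  let d := X * f - Y * e in let d' := X * f' - Y * e' in
  (e - f) * d' - (e' - f') * d =
  s * (d * d' + (X + Y - U) * (e - f) * d' + U * (e' - f') * d
       + X * Y * ((e - f) * (e' - f'))).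
Proof. rewrite /=; ring. Qed.

(** * The q-difference equation of F and its symmetry under inverting q *)

Section FEquation.
Variables (K : fieldType) (u1 u2 u3 u4 q x y : K).
Hypothesis q_neq0 : q != 0.
Hypothesis q_not_root1 : forall n : nat, (0 < n)%N -> q ^+ n != 1.
Hypothesis x_neq_y : x != y.
Hypothesis xy_sum : x + y = u3 + u4.
Hypothesis xy_prod : x * y = u1 * u2.
Implicit Types (c : K) (f : fps K).

(** The product is invariant under dilation by [q]: the first factor gains [1 - (1-q) c z], and the
    equation for base [q^-1], dilated by [q], shows that the second loses the same factor. *)
Lemma qexp_inv c : fps_dil c (qexp q) * fps_dil (- c) (qexp q^-1) = 1.
Proof.
apply: (fps_dil_fixed q_not_root1); last by rewrite coefs0M !coefs0_qexp mulr1.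
have := @qexp_dil _ q^-1 (invq_not_root1 q_not_root1) (- c).
move/(congr1 (fps_dil q)); rewrite fps_dil_dil mulfV // fps_dil_id.
move=> EE; rewrite fps_dilM (qexp_dil q_not_root1) [in RHS]EE fps_dilM.
rewrite fps_dilD fps_dilN fps_dilZ fps_dil_z fps_dil1 scalerA.
rewrite (_ : (1 - q^-1) * - c * q = (1 - q) * c); last by field.
by rewrite -mulrA [_ * fps_dil q _]mulrC.
Qed.

Let ex := fps_dil (x - u4) (qexp q).
Let ey := fps_dil (y - u4) (qexp q).
Let den := x *: ey - y *: ex.

Lemma Fser_den_unit : den \is a GRing.unit.
Proof.
by rewrite fps_unitE coefsB !coefsZ !coefs0_qexp !mulr1 subr_eq0.
Qed.

Lemma Fser_invq : Fser u1 x y u3 q^-1 = Fser u1 x y u4 q.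
Proof.
rewrite /Fser -/ex -/ey -/den.
set ex' := fps_dil (x - u3) _; set ey' := fps_dil (y - u3) _.
have xu : x = u3 + u4 - y by rewrite -xy_sum addrK.
have yE : ey * ex' = 1.
  by rewrite /ex' (_ : x - u3 = - (y - u4)) ?qexp_inv // xu; ring.
have xE : ex * ey' = 1.
  by rewrite /ey' (_ : y - u3 = - (x - u4)) ?qexp_inv // xu; ring.
have U' : x *: ey' - y *: ex' \is a GRing.unit.
  by rewrite fps_unitE coefsB !coefsZ !coefs0_qexp !mulr1 subr_eq0.
suff -> : (ex' - ey') / (x *: ey' - y *: ex') = (ex - ey) / den by [].
apply: (mulIr U'); rewrite divrK // mulrAC.
apply: (mulIr Fser_den_unit); rewrite divrK ?Fser_den_unit // /den.
rewrite !fps_scaleE.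
exact: swap_inv_identity.
Qed.

Lemma Fser0 : coefs (Fser u1 x y u4 q) 0 = 0.
Proof. by rewrite coefsZ coefs0M coefsB !coefs0_qexp subrr mul0r mulr0. Qed.

Lemma Fser_dil : let F := Fser u1 x y u4 q in
  F - fps_dil q F = (1 - q) *: (fps_z *
    (u1%:A + u3 *: F + u4 *: fps_dil q F + u2 *: (F * fps_dil q F))).
Proof.
rewrite /Fser -/ex -/ey -/den fps_dilZ.
set G := (ex - ey) / den; set G' := fps_dil q G.
have UD := Fser_den_unit.
have UD' : fps_dil q den \is a GRing.unit by rewrite fps_dil_unit.
have GE : G * den = ex - ey by rewrite divrK.
have GE' : G' * fps_dil q den = fps_dil q (ex - ey) by rewrite -fps_dilM GE.
(* Since [F] is [u1] times [G], a factor [u1] comes out of every term, and the quadratic term keeps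
   [u1 * u2], which is [x * y]. *)
suff E : G - G' = (1 - q) *: (fps_z *
    (1 + u3 *: G + u4 *: G' + (x * y) *: (G * G'))).
  by rewrite -scalerBr E xy_prod !fps_scaleE rmorphM /=; ring.
apply: (mulIr UD); apply: (mulIr UD').
have -> : (G - G') * den * fps_dil q den
    = (G * den) * fps_dil q den - (G' * fps_dil q den) * den by ring.
have -> : (1 - q) *: (fps_z * (1 + u3 *: G + u4 *: G' + (x * y) *: (G * G')))
    * den * fps_dil q den = (1 - q) *: (fps_z *
   (den * fps_dil q den + u3 *: (G * den) * fps_dil q den
    + u4 *: (G' * fps_dil q den) * den
    + (x * y) *: ((G * den) * (G' * fps_dil q den)))).
  rewrite !fps_scaleE; ring.
rewrite GE GE' /den !fps_dilD !fps_dilN !fps_dilZ !qexp_dil // -/ex -/ey.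
rewrite !fps_scaleE.
have -> : u3 = x + y - u4 by rewrite xy_sum addrK.
rewrite !rmorphM !rmorphB rmorphD rmorph1 /= !fps_scaleE !mulr1.
set S := 1 - GRing.in_alg (fps K) q.
rewrite !(mulrAC S _ fps_z) (mulrA S fps_z); exact: riccati_identity.
Qed.
End FEquation.

(** * Decomposition of a word at its maximal letter *)

Section Splits.
Variable T : eqType.
Implicit Types (s : seq T) (p : seq T * seq T).

(** The possible sets of letters left and right of the maximal letter, each listed in the order of
    [s]; the actual sides are then permutations of these lists. *)
Fixpoint splits s : seq (seq T * seq T) :=
  if s is x :: s' then
    [seq (x :: p.1, p.2) | p <- splits s']
    ++ [seq (p.1, x :: p.2) | p <- splits s']
  else [:: ([::], [::])].

Lemma mem_splits_filter (a : pred T) s :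
  (filter a s, filter (predC a) s) \in splits s.
Proof.
elim: s => [|x s IHs] //=; rewrite mem_cat.
by case: (a x) => /=; apply/orP; [left | right]; apply/mapP;
  exists (filter a s, filter (predC a) s).
Qed.

Lemma perm_splits s p : p \in splits s -> perm_eq (p.1 ++ p.2) s.
Proof.
elim: s p => [|x s IHs] p /=; first by rewrite inE => /eqP->.
rewrite mem_cat => /orP[] /mapP[p' /IHs Ep' ->] /=; first by rewrite perm_cons.
by rewrite -[x :: p'.2]cat1s perm_catCA /= perm_cons.
Qed.

Lemma subseq_splits s p : p \in splits s -> subseq p.1 s /\ subseq p.2 s.
Proof.
elim: s p => [|x s IHs] p; first by rewrite inE => /eqP->.
rewrite [splits _]/= mem_cat => /orP[] /mapP[p' /IHs[s1 s2] ->].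
  by rewrite /= eqxx; split=> //; apply: subseq_trans s2 (subseq_cons _ _).
by rewrite /= eqxx; split=> //; apply: subseq_trans s1 (subseq_cons _ _).
Qed.

(** A split of a duplicate-free word is determined by the letters of its first component; this gives
    injectivity of the decomposition at [m]. *)
Lemma splits_filterE s p : uniq s -> p \in splits s ->
  p = (filter (mem p.1) s, filter (predC (mem p.1)) s).
Proof.
elim: s p => [|x s IHs] p; first by rewrite inE => _ /eqP->.
rewrite cons_uniq => /andP[xNs Us]; rewrite [splits _]/= mem_cat.
case/orP=> /mapP[[l r] lrs ->]; have [El Er] := IHs _ Us lrs.
  have Ex : {in s, mem (x :: l) =1 mem l}.
    move=> y ys; rewrite /= inE; have [yx|//] := eqVneq y x.
    by rewrite -yx ys in xNs.
  rewrite /= mem_head /= (eq_in_filter Ex) -El; congr (_ :: _, _).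
  rewrite [LHS]Er; apply: eq_in_filter => y /Ex Ey.
  by rewrite -[LHS]/(~~ (mem l y)) -Ey.
have xNl : x \in l = false.
  by apply/negbTE; apply: contra xNs; apply: (mem_subseq (subseq_splits lrs).1).
by rewrite /= xNl /= -El -Er.
Qed.

Lemma splits_uniq s : uniq s -> uniq (splits s).
Proof.
elim: s => [|x s IHs] //= /andP[xNs /IHs Us].
rewrite cat_uniq !map_inj_uniq ?Us; try by move=> [? ?] [? ?] [] // -> ->.
rewrite /= andbT; apply/hasPn => _ /mapP[p ps ->]; apply/mapP => -[p' p's [E _]].
have := mem_subseq (subseq_splits ps).1; move/(_ x); rewrite E mem_head => /(_ isT).
by rewrite (negPf xNs).
Qed.

Lemma cat_cons_inj (m : T) s1 s2 r1 r2 : m \notin s1 -> m \notin r1 ->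
  s1 ++ m :: s2 = r1 ++ m :: r2 -> s1 = r1 /\ s2 = r2.
Proof.
elim: s1 r1 => [|x s1 IHs] [|y r1] //=; rewrite ?inE ?negb_or.
- by move=> _ _ [].
- by move=> _ /andP[/eqP myN _] [/myN].
- by move=> /andP[/eqP mxN _] _ [/esym/mxN].
by move=> /andP[_ ms] /andP[_ mr] [-> /IHs[] // -> ->].
Qed.

(** The letter [m] occurs once in such a word, so cutting there recovers the two sides, and the
    letters of the left side recover the split. *)
Lemma permutations_cons_splits (m : T) s : m \notin s -> uniq s ->
  perm_eq (permutations (m :: s))
    [seq w.1 ++ m :: w.2 | p <- splits s,
      w <- [seq (wl, wr) | wl <- permutations p.1, wr <- permutations p.2]].
Proof.
move=> mNs Us; apply: uniq_perm; first exact: permutations_uniq.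
  apply: allpairs_uniq_dep; first exact: splits_uniq.
    move=> p _; apply: allpairs_uniq; rewrite ?permutations_uniq //.
    by move=> [? ?] [? ?].
  (* The data needed for injectivity: the left side has the letters of the first component, hence
     avoids [m]. *)
  have memP (u : {_ : seq T * seq T & (seq T * seq T)%type}) :
    u \in [seq @Tagged _ p (fun=> (seq T * seq T)%type) w | p <- splits s,
              w <- [seq (wl, wr) | wl <- permutations p.1, wr <- permutations p.2]] ->
    [/\ tag u \in splits s, perm_eq (tagged u).1 (tag u).1 &
        m \notin (tagged u).1].
    case/allpairsPdep=> p [_ [ps /allpairsP[[wl wr] [/= wlp _ ->]] ->]] /=.
    rewrite mem_permutations in wlp.
split; [exact: ps | exact: wlp | ].
    rewrite /=; apply: contra mNs; rewrite -[_ \in _]/(m \in wl) (perm_mem wlp).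
    exact: (mem_subseq (subseq_splits ps).1).
  move=> [p w] [p' w'] /memP[/= ps wp mNw] /memP[/= ps' wp' mNw'].
  case/(cat_cons_inj mNw mNw') => E1 E2.
  have Ew : w = w' by rewrite [w]surjective_pairing E1 E2 -surjective_pairing.
  suff Ep : p = p' by rewrite Ep Ew.
  rewrite (splits_filterE Us ps) (splits_filterE Us ps').
  have Em : mem p.1 =1 mem p'.1.
    by move=> y; rewrite /= -(perm_mem wp) -(perm_mem wp') Ew.
  by congr (_, _); apply: eq_filter => y //; rewrite -[LHS]/(~~ _) Em.
move=> w; rewrite mem_permutations; apply/idP/allpairsPdep.
  move=> ws; have mw : m \in w by rewrite (perm_mem ws) mem_head.
  case/splitPr: mw ws => w1 w2 ws.
  have Uw : uniq (w1 ++ m :: w2) by rewrite (perm_uniq ws) /= mNs.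
  have {}ws : perm_eq (w1 ++ w2) s.
    by move: ws; rewrite -[m :: w2]cat1s perm_catCA /= perm_cons.
  have U12 : uniq (w1 ++ w2) by rewrite (perm_uniq ws).
  (* The split is read off the word: each letter of [s] goes left exactly when it occurs in [w1]. *)
  exists (filter (mem w1) s, filter (predC (mem w1)) s), (w1, w2).
  split=> //; first exact: mem_splits_filter.
  apply/allpairsP; exists (w1, w2); rewrite /= !mem_permutations; split=> //.
    apply: uniq_perm; rewrite ?filter_uniq //.
      by move: U12; rewrite cat_uniq => /andP[].
    by move=> y; rewrite mem_filter /= -(perm_mem ws) mem_cat; case: (y \in w1).
  move: U12; rewrite cat_uniq => /and3P[_ /hasPn w12 U2].
  apply: uniq_perm; rewrite ?filter_uniq // => y.
  rewrite mem_filter /= -(perm_mem ws) mem_cat.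
  by have := w12 y; case: (y \in w1); case: (y \in w2) => //= /(_ isT).
case=> p [_ [ps /allpairsP[[wl wr] [/= wlp wrp ->]] ->]] /=.
rewrite !mem_permutations in wlp wrp.
rewrite -[m :: wr]cat1s perm_catCA /= perm_cons.
exact: perm_trans (perm_cat wlp wrp) (perm_splits ps).
Qed.
End Splits.

(** * Statistics on words with boundary letters *)

Section WordStats.
Local Open Scope nat_scope.
Implicit Types (P : nat -> nat -> nat -> bool) (a b m : nat) (w : seq nat).

(* a and b are the letters before and after w; a boundary letter exceeding all
   letters of w stands for infinity, and then wlma and wrma vanish. *)
Fixpoint wcount P a w b : nat :=
  if w is x :: w' then P a x (head b w') + wcount P x w' b else 0.

Fixpoint wlma a w : nat :=
  if w is x :: w' then (a < x) + wlma (maxn a x) w' else 0.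

Fixpoint wrma w b : nat :=
  if w is x :: w' then (all (gtn x) w' && (b < x)) + wrma w' b else 0.

Fixpoint winv w : nat :=
  if w is x :: w' then count (gtn x) w' + winv w' else 0.

Definition cross w1 w2 : nat := \sum_(x <- w1) count (gtn x) w2.

Definition is_valley p x n := (x < p) && (x < n).
Definition is_peak p x n := (p < x) && (n < x).
Definition is_dasc p x n := (p < x) && (x < n).
Definition is_ddes p x n := (x < p) && (n < x).

Lemma wcount_cat P a w1 m w2 b :
  wcount P a (w1 ++ m :: w2) b =
  wcount P a w1 m + P (last a w1) m (head b w2) + wcount P m w2 b.
Proof.
elim: w1 a => [|x w1 IHw] a //=; rewrite IHw !addnA.
by congr (_ + _ + _ + _); case: w1 {IHw}.
Qed.

Lemma wlma0 a w : all (gtn a) w -> wlma a w = 0.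
Proof.
elim: w => //= x w IHw /andP[/= xa aw].
by rewrite ltnNge (ltnW xa) /= (maxn_idPl (ltnW xa)) IHw.
Qed.

(** No letter of [w2] is a record after [m], while [m] exceeds all of [w1], so it is a record as
    soon as it exceeds [a]. *)
Lemma wlma_cat a w1 m w2 : all (gtn m) w1 -> all (gtn m) w2 ->
  wlma a (w1 ++ m :: w2) = wlma a w1 + (a < m).
Proof.
move=> m1 m2; elim: w1 a m1 => [|x w1 IHw] a /=.
  rewrite wlma0 ?addn0 //; apply: sub_all m2 => x /= xm.
  exact: leq_trans xm (leq_maxr _ _).
by case/andP=> xm /IHw->; rewrite addnA gtn_max xm andbT.
Qed.

Lemma wrma0 b w : all (gtn b) w -> wrma w b = 0.
Proof.
by elim: w => //= x w IHw /andP[/= xb /IHw->]; rewrite ltnNge ltnW // andbF.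
Qed.

Lemma wrma_cat w1 m w2 b : all (gtn m) w1 -> all (gtn m) w2 ->
  wrma (w1 ++ m :: w2) b = (b < m) + wrma w2 b.
Proof.
move=> m1 m2; elim: w1 m1 => [|x w1 IHw] /=; first by rewrite m2.
case/andP=> xm /IHw->; rewrite all_cat /= [m < x]ltnNge (ltnW xm) /=.
by rewrite andbF.
Qed.

Lemma winv_cat w1 m w2 : all (gtn m) w1 -> all (gtn m) w2 ->
  winv (w1 ++ m :: w2) = winv w1 + winv w2 + (size w2 + cross w1 w2).
Proof.
move=> m1 m2; elim: w1 m1 => [|x w1 IHw] /=.
  by rewrite /cross big_nil addn0 addnC; move: m2; rewrite all_count => /eqP->.
case/andP=> xm /IHw->; rewrite /cross big_cons count_cat /=.
by rewrite [m < x]ltnNge (ltnW xm) /=; lia.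
Qed.

Lemma perm_cross w1 w1' w2 w2' : perm_eq w1 w1' -> perm_eq w2 w2' ->
  cross w1 w2 = cross w1' w2'.
Proof.
move=> E1 /seq.permP E2; rewrite /cross (perm_big _ E1).
by apply: eq_bigr => x _; apply: E2.
Qed.
End WordStats.

(** * Gaussian binomials from cross inversions *)

Section SplitSums.
Variables (K : fieldType) (q : K).
Hypothesis q_not_root1 : forall n : nat, (0 < n)%N -> q ^+ n != 1.

(** The head [x] is the largest letter: put on the left it is inverted with all of [p.2], put on the
    right with nothing. This is the q-Pascal rule; the arbitrary [f] lets the induction absorb the
    resulting power of [q]. *)
Lemma sum_splits_cross (s : seq nat) (f : nat -> nat -> K) : pairwise gtn s ->
  \sum_(p <- splits s) q ^+ cross p.1 p.2 * f (size p.1) (size p.2)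
  = \sum_(j < (size s).+1)
      qfact q (size s) / (qfact q j * qfact q (size s - j)) * f j (size s - j)%N.
Proof.
elim: s f => [|x s IHs] f.
  rewrite /= big_seq1 big_ord1 /cross big_nil !qfact0 expr0.
  by rewrite mulr1 divr1.
rewrite pairwise_cons => /andP[xs /IHs{}IHs].
rewrite [splits _]/= big_cat !big_map /=.
under eq_big_seq => p ps.
  have [_ s2] := subseq_splits ps.
  have c2 : count (gtn x) p.2 = size p.2.
    by apply/eqP; rewrite -all_count; apply/allP => y /(mem_subseq s2)/(allP xs).
  rewrite /cross big_cons c2 -/(cross p.1 p.2) exprD [q ^+ size _ * _]mulrC -mulrA.
  over.
rewrite (IHs (fun j k => q ^+ k * f j.+1 k)).
under [X in _ + X]eq_big_seq => p ps.
  have [s1 _] := subseq_splits ps.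
  have c1 : cross p.1 (x :: p.2) = cross p.1 p.2.
    apply: eq_big_seq => y /(mem_subseq s1)/(allP xs) /= yx.
    by rewrite ltnNge ltnW.
  rewrite c1.
  over.
rewrite (IHs (fun j k => f j k.+1)) /=.
set n := size s.
(* The q-Pascal rule; the zero branches cover [j = 0] and [j = n.+1], where one of the two binomials
   is absent. *)
have E j : (j <= n.+1)%N ->
    qfact q n.+1 / (qfact q j * qfact q (n.+1 - j)) * f j (n.+1 - j)%N =
    (if j is j'.+1 then qfact q n / (qfact q j' * qfact q (n - j'))
        * (q ^+ (n - j') * f j (n - j')%N) else 0)
    + (if (j <= n)%N then qfact q n / (qfact q j * qfact q (n - j))
        * f j (n - j).+1 else 0).
  move=> lejn; have Q := qfact_neq0 q_not_root1.
  have H := qfactS q; have q1 := subr1q_neq0 q_not_root1.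
  have Z k : qfact q k.+1 = (1 - q ^+ k.+1) / (1 - q) * qfact q k.
    by rewrite mulrAC -H mulrAC mulfV // mul1r.
  have N := subr1X_neq0 q_not_root1.
  case: j lejn => [|j] lejn.
    by rewrite !subn0 qfact0 leq0n !mul1r !divff ?Q // !mul1r add0r.
  rewrite subSS; move: lejn; rewrite ltnS leq_eqVlt => /orP[/eqP->|ltjn].
    by rewrite ltnn subnn !qfact0 !mulr1 !divff ?Q // !mul1r addr0.
  rewrite ltjn; have [k Ek] : exists k, (n - j)%N = k.+1.
    by exists (n - j).-1; rewrite prednK ?subn_gt0.
  have -> : (n - j.+1)%N = k by lia.
  have -> : n = (j + k.+1)%N by lia.
  rewrite addKn !Z; have -> : q ^+ (j + k.+1).+1 = q ^+ j.+1 * q ^+ k.+1.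
    by rewrite -exprD addSn.
  field.
  by rewrite !N !Q q1.
rewrite [RHS](eq_bigr _ (fun (j : 'I_n.+2) _ => E j _)); last first.
  by move=> j _; rewrite -ltnS.
rewrite big_split /=; congr (_ + _).
  by rewrite [RHS]big_ord_recl /= add0r; apply: eq_bigr.
rewrite [RHS]big_ord_recr /= ltnn addr0; apply: eq_bigr => j _.
by rewrite -ltnS ltn_ord.
Qed.
End SplitSums.

(** * Weights of words and their sums over arrangements *)

Section WordSums.
Variables (K : fieldType) (u1 u2 u3 u4 alpha beta q : K).
Hypothesis q_not_root1 : forall n : nat, (0 < n)%N -> q ^+ n != 1.
Implicit Types (a b m : nat) (w s : seq nat).

Definition weight a w b : K :=
  u1 ^+ wcount is_valley a w b * u2 ^+ wcount is_peak a w b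
  * u3 ^+ wcount is_dasc a w b * u4 ^+ wcount is_ddes a w b
  * alpha ^+ wlma a w * beta ^+ wrma w b * q ^+ winv w.

(* l and r tell whether the left and right neighbours are smaller. *)
Definition max_factor (l r : bool) : K :=
  if l then (if r then u2 else u3) else (if r then u4 else u1).

Lemma last_ltn a w m : all (gtn m) w ->
  (last a w < m)%N = (0 < size w)%N || (a < m)%N.
Proof.
case/lastP: w => //= w x; rewrite all_rcons last_rcons size_rcons /=.
by case/andP=> ->.
Qed.

Lemma head_ltn b w m : all (gtn m) w ->
  (head b w < m)%N = (0 < size w)%N || (b < m)%N.
Proof. by case: w => //= x w /andP[->]. Qed.

Lemma last_neq a w m : all (gtn m) w -> a != m -> last a w != m.
Proof.
move=> mw am; case/lastP: w mw => //= w x; rewrite all_rcons last_rcons /=.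
by case/andP=> xm _; rewrite ltn_eqF.
Qed.

Lemma head_neq b w m : all (gtn m) w -> b != m -> head b w != m.
Proof. by case: w => //= x w /andP[/= xm _] _; rewrite ltn_eqF. Qed.

(** The letter [m] acts as an infinite boundary for both sides. Its own neighbour on a side is
    smaller exactly when that side is nonempty or the outer boundary is below [m]. *)
Lemma weight_cat a w1 m w2 b : all (gtn m) w1 -> all (gtn m) w2 ->
    a != m -> b != m ->
  weight a (w1 ++ m :: w2) b =
    weight a w1 m * weight m w2 b
    * max_factor ((0 < size w1) || (a < m))%N ((0 < size w2) || (b < m))%N
    * alpha ^+ (a < m)%N * beta ^+ (b < m)%N * q ^+ (size w2 + cross w1 w2).
Proof.
move=> m1 m2 am bm; rewrite /weight !wcount_cat wlma_cat // wrma_cat // winv_cat //.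
rewrite (wlma0 m2) (wrma0 m1).
have El := last_ltn a m1; have Er := head_ltn b m2.
have := last_neq m1 am; have := head_neq m2 bm.
rewrite -{}El -{}Er; move: (last a w1) (head b w2) => c d dm cm.
rewrite /is_valley /is_peak /is_dasc /is_ddes /max_factor.
(* Neither neighbour equals [m], so [m] has exactly one of the four types. *)
by case: (ltngtP c m) cm => // _ _; case: (ltngtP d m) dm => // _ _;
  rewrite /= !exprD !expr0 ?expr1; ring.
Qed.

Definition wsum a s b : K := \sum_(w <- permutations s) weight a w b.

Lemma wsum_nil a b : wsum a [::] b = 1.
Proof. by rewrite /wsum big_seq1 /weight /= !mulr1. Qed.

Lemma big_permutations_max (g : seq nat -> K) m s : pairwise gtn (m :: s) ->
  \sum_(w <- permutations (m :: s)) g w =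
  \sum_(p <- splits s) \sum_(w1 <- permutations p.1) \sum_(w2 <- permutations p.2)
     g (w1 ++ m :: w2).
Proof.
rewrite pairwise_cons => /andP[ms ps].
have mNs : m \notin s by apply/negP => /(allP ms) /=; rewrite ltnn.
have Us : uniq s.
  by apply: pairwise_uniq ps => x; rewrite /= ltnn.
rewrite (perm_big _ (permutations_cons_splits mNs Us)) big_allpairs_dep.
by apply: eq_bigr => p _; rewrite big_allpairs.
Qed.

(** The q-factorials of the two sides cancel the denominator of the Gaussian binomial and leave an
    ordinary Cauchy product, with [Y] dilated by [q]. The general [g] covers both [weight] and
    [reduced_weight]. *)
Lemma sum_permutations_max (g : seq nat -> K) a m s b (h : nat -> nat -> K)
    (X Y : nat -> K) : pairwise gtn (m :: s) ->
    (forall w1 w2, all (gtn m) w1 -> all (gtn m) w2 ->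
      g (w1 ++ m :: w2) = weight a w1 m * weight m w2 b
        * h (size w1) (size w2) * q ^+ (size w2 + cross w1 w2)) ->
    (forall p, p \in splits s ->
       wsum a p.1 m = qfact q (size p.1) * X (size p.1)) ->
    (forall p, p \in splits s ->
       wsum m p.2 b = qfact q (size p.2) * Y (size p.2)) ->
  \sum_(w <- permutations (m :: s)) g w =
  qfact q (size s) * \sum_(j < (size s).+1)
     h j (size s - j)%N * X j * (q ^+ (size s - j)%N * Y (size s - j)%N).
Proof.
move=> pms gE XE YE; rewrite big_permutations_max //.
move: pms; rewrite pairwise_cons => /andP[ms ps].
under eq_big_seq => p p_s.
  have [s1 s2] := subseq_splits p_s.
  have m1 : all (gtn m) p.1 by apply/allP => x /(mem_subseq s1)/(allP ms).
  have m2 : all (gtn m) p.2 by apply/allP => x /(mem_subseq s2)/(allP ms).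
  have -> : \sum_(w1 <- permutations p.1) \sum_(w2 <- permutations p.2)
       g (w1 ++ m :: w2) = q ^+ cross p.1 p.2 *
         ((qfact q (size p.1) * X (size p.1)) * (qfact q (size p.2) * Y (size p.2))
         * h (size p.1) (size p.2) * q ^+ size p.2).
    rewrite -XE // -YE // /wsum !mulr_suml mulr_sumr; apply: eq_big_seq => w1.
    rewrite mem_permutations => pw1.
    rewrite mulr_sumr !mulr_suml mulr_sumr; apply: eq_big_seq => w2.
    rewrite mem_permutations => pw2.
    rewrite gE ?(eq_all_r (perm_mem pw1)) ?(eq_all_r (perm_mem pw2)) //.
    rewrite (perm_size pw1) (perm_size pw2) (perm_cross pw1 pw2) exprD.
    by ring.
  over.
rewrite (sum_splits_cross q_not_root1 (fun j k => qfact q j * X j *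
   (qfact q k * Y k) * h j k * q ^+ k)) // mulr_sumr.
apply: eq_bigr => j _; have Q := qfact_neq0 q_not_root1.
by field; rewrite !Q.
Qed.
End WordSums.

(** * Generating functions of words *)

Section WordSeries.
Variables (K : fieldType) (u1 u2 u3 u4 alpha beta q : K).
Hypothesis q_neq0 : q != 0.
Hypothesis q_not_root1 : forall n : nat, (0 < n)%N -> q ^+ n != 1.
Implicit Types (a b m : nat) (w s : seq nat).

Local Notation wsum := (wsum u1 u2 u3 u4 alpha beta q).
Local Notation weight := (weight u1 u2 u3 u4 alpha beta q).

(** The hypothesis says that [g] is the q-derivative of [f]. *)
Lemma coefs_qderiv (f g : fps K) n :
    f - fps_dil q f = (1 - q) *: (fps_z * g) ->
  qfact q n.+1 * coefs f n.+1 = qfact q n * coefs g n.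
Proof.
move/fpsP/(_ n.+1); rewrite coefsB coefs_dil coefsZ coefs_zM => E.
apply: (mulfI (subr1q_neq0 q_not_root1)).
by rewrite mulrA qfactS mulrAC mulrBl mul1r E; ring.
Qed.

Lemma wsum_max a m s b (X Y : nat -> K) : pairwise gtn (m :: s) ->
    a != m -> b != m ->
    (forall p, p \in splits s ->
       wsum a p.1 m = qfact q (size p.1) * X (size p.1)) ->
    (forall p, p \in splits s ->
       wsum m p.2 b = qfact q (size p.2) * Y (size p.2)) ->
  wsum a (m :: s) b =
  qfact q (size s) * \sum_(j < (size s).+1)
    max_factor u1 u2 u3 u4 ((0 < j) || (a < m))%N ((0 < size s - j) || (b < m))%N
    * alpha ^+ (a < m)%N * beta ^+ (b < m)%N
    * X j * (q ^+ (size s - j)%N * Y (size s - j)%N).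
Proof.
move=> pms am bm XE YE.
apply: (sum_permutations_max q_not_root1 (h := fun j k =>
    max_factor u1 u2 u3 u4 ((0 < j) || (a < m))%N ((0 < k) || (b < m))%N
    * alpha ^+ (a < m)%N * beta ^+ (b < m)%N) pms _ XE YE) => w1 w2 m1 m2.
by rewrite weight_cat // !mulrA.
Qed.

Lemma splits_pairwise s p : pairwise gtn s -> p \in splits s ->
  [/\ pairwise gtn p.1, pairwise gtn p.2, (size p.1 <= size s)%N,
      (size p.2 <= size s)%N & forall P, all P s -> all P p.1 /\ all P p.2].
Proof.
move=> ps /subseq_splits[s1 s2]; split; try exact: size_subseq.
- exact: subseq_pairwise s1 ps.
- exact: subseq_pairwise s2 ps.
move=> P /allP Ps; split; apply/allP => x.
  by move/(mem_subseq s1)/Ps.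
by move/(mem_subseq s2)/Ps.
Qed.

Variable F : fps K.
Hypothesis F0 : coefs F 0 = 0.
Hypothesis F_dil : F - fps_dil q F = (1 - q) *: (fps_z *
  (u1%:A + u3 *: F + u4 *: fps_dil q F + u2 *: (F * fps_dil q F))).

Lemma pairwise_max m s : pairwise gtn (m :: s) ->
  [/\ all (gtn m) s, pairwise gtn s & forall p, p \in splits s ->
   [/\ pairwise gtn p.1, pairwise gtn p.2, all (gtn m) p.1 & all (gtn m) p.2]].
Proof.
rewrite pairwise_cons => /andP[ms ps]; split=> // p.
by case/(splits_pairwise ps) => p1 p2 _ _ /(_ _ ms)[].
Qed.

Lemma wsum_above a s b : pairwise gtn s -> all (gtn a) s -> all (gtn b) s ->
  wsum a s b = qfact q (size s) * coefs (1 + F) (size s).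
Proof.
(* Induction on a bound for the size, as the components of a split are not tails of [s]. *)
move: {2}(size s) (leqnn (size s)) => n.
elim: n s a b => [|n IHn] [|m s] a b //; rewrite ?wsum_nil;
  try by rewrite coefsD coefs1 F0 addr0 mulr1 qfact0.
rewrite [size _]/= ltnS => len pms /andP[/= ma _] /andP[/= mb _].
have [ms ps sP] := pairwise_max pms.
rewrite (@wsum_max _ _ _ _ (coefs (1 + F)) (coefs (1 + F))) ?gtn_eqF //; first last.
- move=> p p_s; have [p1 p2 m1 m2] := sP p p_s.
  have [_ _ _ l2 Pp] := splits_pairwise ps p_s.
  apply: IHn => //; first exact: leq_trans l2 len.
  by apply: sub_all m2 => x xm; exact: ltn_trans xm mb.
- move=> p p_s; have [p1 p2 m1 m2] := sP p p_s.
  have [_ _ l1 _ Pp] := splits_pairwise ps p_s.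
  apply: IHn => //; first exact: leq_trans l1 len.
  by apply: sub_all m1 => x xm; exact: ltn_trans xm ma.
rewrite add0r (coefs_qderiv _ F_dil); congr (_ * _).
(* The four terms are the four cases of empty or nonempty sides: 1 stands for an empty side, and
   [F], having no constant term, for a nonempty one. *)
have -> : u1%:A + u3 *: F + u4 *: fps_dil q F + u2 *: (F * fps_dil q F)
  = u1 *: (1 * 1) + u3 *: (F * 1) + u4 *: (1 * fps_dil q F)
    + u2 *: (F * fps_dil q F) by rewrite !mulr1 mul1r.
rewrite !coefsD !coefsZ !coefsM !mulr_sumr -!big_split; apply: eq_bigr => j _ /=.
rewrite [(a < m)%N]ltnNge [(b < m)%N]ltnNge (ltnW ma) (ltnW mb) !orbF !expr0 !mulr1.
case: (j : nat) => [|i]; case: (size s - _)%N => [|l]; rewrite /= ?F0; ring.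
Qed.

Variable A : fps K.
Hypothesis A0 : coefs A 0 = 1.
Hypothesis A_dil : fps_dil q A =
  A * (1 - ((1 - q) * alpha) *: (fps_z * (u3%:A + u2 *: fps_dil q F))).

Lemma wsum_below_above a s b :
    pairwise gtn s -> all (ltn a) s -> all (gtn b) s ->
  wsum a s b = qfact q (size s) * coefs A (size s).
Proof.
move: {2}(size s) (leqnn (size s)) => n.
elim: n s a b => [|n IHn] [|m s] a b //; rewrite ?wsum_nil;
  try by rewrite A0 mulr1 qfact0.
rewrite [size _]/= ltnS => len pms /andP[/= ma a_s] /andP[/= mb _].
have [ms ps sP] := pairwise_max pms.
rewrite (@wsum_max _ _ _ _ (coefs A) (coefs (1 + F))) ?neq_ltn ?ma ?mb ?orbT //;
  first last.
- move=> p p_s; have [p1 p2 m1 m2] := sP p p_s.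
  apply: wsum_above => //; apply: sub_all m2 => x xm; exact: ltn_trans xm mb.
- move=> p p_s; have [p1 p2 m1 m2] := sP p p_s.
  have [_ _ l1 _ Pp] := splits_pairwise ps p_s.
  apply: IHn => //; first exact: leq_trans l1 len.
  exact: (Pp _ a_s).1.
(* As [a] is below [m], the left neighbour of [m] is always smaller: only [u3] (right side empty)
   and [u2] (nonempty) occur. *)
have AE : A - fps_dil q A =
    (1 - q) *: (fps_z * (alpha *: (A * (u3%:A + u2 *: fps_dil q F)))).
  by rewrite A_dil !fps_scaleE rmorphM /=; ring.

rewrite (coefs_qderiv _ AE); congr (_ * _).
rewrite coefsZ coefsM !mulr_sumr; apply: eq_bigr => j _ /=.
rewrite [(b < m)%N]ltnNge (ltnW mb) expr0 expr1 orbT orbF.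
case: (size s - _)%N => [|l]; rewrite /= ?F0; ring.
Qed.

Variable B : fps K.
Hypothesis B0 : coefs B 0 = 1.
Hypothesis B_dil : fps_dil q^-1 B =
  B * (1 - ((q - 1) * beta) *: (fps_z * (u4%:A + u2 *: F))).

Lemma wsum_above_below a s b :
    pairwise gtn s -> all (gtn a) s -> all (ltn b) s ->
  wsum a s b = qfact q (size s) * coefs (fps_dil q^-1 B) (size s).
Proof.
have BqE : fps_dil q (fps_dil q^-1 B) = B.
  by rewrite fps_dil_dil mulfV // fps_dil_id.
move: {2}(size s) (leqnn (size s)) => n.
elim: n s a b => [|n IHn] [|m s] a b //; rewrite ?wsum_nil;
  try by rewrite /= B0 !mulr1 qfact0.
rewrite [size _]/= ltnS => len pms /andP[/= ma _] /andP[/= mb b_s].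
have [ms ps sP] := pairwise_max pms.
rewrite (@wsum_max _ _ _ _ (coefs (1 + F)) (coefs (fps_dil q^-1 B)))
  ?neq_ltn ?ma ?mb ?orbT //; first last.
- move=> p p_s; have [p1 p2 m1 m2] := sP p p_s.
  have [_ _ _ l2 Pp] := splits_pairwise ps p_s.
  apply: IHn => //; first exact: leq_trans l2 len.
  exact: (Pp _ b_s).2.
- move=> p p_s; have [p1 p2 m1 m2] := sP p p_s.
  apply: wsum_above => //; apply: sub_all m1 => x xm; exact: ltn_trans xm ma.
(* The words are enumerated by [B(t/q)], whose dilation by [q] is [B]; so [B_dil] gives its
   q-derivative, and the power of [q] on the right side turns [B(t/q)] into [B]. *)
have BE : fps_dil q^-1 B - fps_dil q (fps_dil q^-1 B) =
    (1 - q) *: (fps_z * (beta *: ((u4%:A + u2 *: F) * B))).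
  by rewrite BqE B_dil !fps_scaleE !rmorphM !rmorphB rmorph1 /= ; ring.
rewrite (coefs_qderiv _ BE); congr (_ * _).
rewrite -{2}BqE coefsZ coefsM !mulr_sumr; apply: eq_bigr => j _ /=.
rewrite [(a < m)%N]ltnNge (ltnW ma) expr0 expr1 orbT orbF.
case: (j : nat) => [|i]; rewrite /= ?F0; ring.
Qed.

(** Between boundaries 0 the maximal letter is a peak and a record from both ends; the lowered
    exponents remove exactly its factors [u2], [alpha] and [beta]. *)
Definition reduced_weight w : K :=
  u1 ^+ wcount is_valley 0 w 0 * u2 ^+ (wcount is_peak 0 w 0).-1
  * u3 ^+ wcount is_dasc 0 w 0 * u4 ^+ wcount is_ddes 0 w 0
  * alpha ^+ (wlma 0 w).-1 * beta ^+ (wrma w 0).-1 * q ^+ winv w.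

Lemma sum_reduced_weight m s : pairwise gtn (m :: s) -> all (ltn 0) (m :: s) ->
  \sum_(w <- permutations (m :: s)) reduced_weight w
  = qfact q (size s) * coefs (A * B) (size s).
Proof.
move=> pms /andP[/= m0 s0]; have [ms ps sP] := pairwise_max pms.
have Bq : fps_dil q (fps_dil q^-1 B) = B.
  by rewrite fps_dil_dil mulfV // fps_dil_id.
rewrite (@sum_permutations_max _ u1 u2 u3 u4 alpha beta q q_not_root1
   reduced_weight 0 m s 0 (fun _ _ => 1) (coefs A) (coefs (fps_dil q^-1 B))) //.
- congr (_ * _); apply: eq_bigr => j _.
  by rewrite mul1r -coefs_dil Bq.
- move=> w1 w2 m1 m2; rewrite /reduced_weight /weight !wcount_cat.
  rewrite wlma_cat // wrma_cat // winv_cat // (wlma0 m2) (wrma0 m1) m0.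
  have := last_ltn 0 m1; have := head_ltn 0 m2; rewrite m0 !orbT.
  move: (last 0%N w1) (head 0%N w2) => c d dm cm.
  rewrite /is_valley /is_peak /is_dasc /is_ddes dm cm.
  rewrite [(m < c)%N]ltnNge [(m < d)%N]ltnNge (ltnW dm) (ltnW cm) /=.
  rewrite !addn0 !addn1 ?addSn ?add1n /=.
  by rewrite !expr0 !exprD; ring.
- move=> p p_s; have [p1 p2 m1 m2] := sP p p_s.
  have [_ _ _ _ Pp] := splits_pairwise ps p_s.
  by apply: wsum_below_above => //; exact: (Pp _ s0).1.
move=> p p_s; have [p1 p2 m1 m2] := sP p p_s.
have [_ _ _ _ Pp] := splits_pairwise ps p_s.
by apply: wsum_above_below => //; exact: (Pp _ s0).2.
Qed.
End WordSeries.

(** * Permutations as words *)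

Section PositionalStats.
Local Open Scope nat_scope.
Implicit Types (P : nat -> nat -> nat -> bool) (p : pred nat) (w : seq nat).

(** This and the next formulas write the recursive statistics by positions, to match the
    cardinalities that define the statistics of permutations. *)
Lemma wcountE P a w b : wcount P a w b =
  \sum_(i < size w) P (nth 0 (a :: w) i) (nth 0 w i) (nth b w i.+1).
Proof.
elim: w a => [|x w IHw] a; first by rewrite big_ord0.
by rewrite big_ord_recl /= -nth0 IHw.
Qed.

Lemma wlmaE a w : wlma a w =
  \sum_(i < size w) ((a < nth 0 w i) && all (gtn (nth 0 w i)) (take i w)).
Proof.
elim: w a => [|x w IHw] a; first by rewrite big_ord0.
rewrite big_ord_recl /= andbT IHw; congr (_ + _); apply: eq_bigr => i _ /=.
by rewrite gtn_max -andbA.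
Qed.

Lemma wrmaE w b : wrma w b =
  \sum_(i < size w) (all (gtn (nth 0 w i)) (drop i.+1 w) && (b < nth 0 w i)).
Proof.
elim: w => [|x w IHw]; first by rewrite big_ord0.
by rewrite big_ord_recl /= drop0 IHw.
Qed.

Lemma winvE w : winv w =
  \sum_(i < size w) count (gtn (nth 0 w i)) (drop i.+1 w).
Proof.
elim: w => [|x w IHw]; first by rewrite big_ord0.
by rewrite big_ord_recl /= drop0 IHw.
Qed.

Lemma count_drop p k w :
  count p (drop k w) = \sum_(j < size w) ((k <= j) && p (nth 0 w j)).
Proof.
elim: w k => [|x w IHw] k; first by rewrite big_ord0.
rewrite big_ord_recl /=; case: k => [|k] /=; last by rewrite add0n IHw.
by rewrite -[w in LHS]drop0 IHw.
Qed.

Lemma all_takeP p k w :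
  reflect (forall j, j < size w -> j < k -> p (nth 0 w j)) (all p (take k w)).
Proof.
apply: (iffP (all_nthP 0)) => H j.
  by move=> jw jk; rewrite -(nth_take 0 jk) H // size_take_min leq_min jk.
by rewrite size_take_min leq_min => /andP[jk jw]; rewrite nth_take // H.
Qed.

Lemma all_dropP p k w :
  reflect (forall j, j < size w -> k <= j -> p (nth 0 w j)) (all p (drop k w)).
Proof.
apply: (iffP (all_nthP 0)) => H j.
  by move=> jw kj; rewrite -(subnKC kj) -nth_drop H // size_drop ltn_sub2rE.
by rewrite size_drop nth_drop => jw; rewrite H ?leq_addr // -ltn_subRL.
Qed.

Lemma card_set_sum n (p : pred 'I_n) : #|[set i | p i]| = \sum_i (p i : nat).
Proof. by rewrite -sum1dep_card big_mkcond; apply: eq_bigr => i _; case: (p i). Qed.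
End PositionalStats.

(** * The word of a permutation *)

Section PermWord.
Variable n : nat.
Implicit Type s : 'S_n.

Definition word s : seq nat := [seq (s i).+1 | i <- enum 'I_n].

Lemma size_word s : size (word s) = n.
Proof. by rewrite size_map size_enum_ord. Qed.

Lemma nth_word s (i : 'I_n) : nth 0%N (word s) i = (s i).+1.
Proof. by rewrite (nth_map i) ?size_enum_ord // nth_ord_enum. Qed.

(** The prepended 0 is the left boundary letter, and the default value 0 of [nth] is the right
    one. *)
Lemma letterE s k : letter s k = nth 0%N (0%N :: word s) k.
Proof.
case: k => //= k; case: insubP => [i _ <-|] /=; first by rewrite nth_word.
by rewrite -leqNgt => lenk; rewrite nth_default // size_word.
Qed.

Lemma wcount_word (P : nat -> nat -> nat -> bool) s : wcount P 0 (word s) 0 =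
  #|[set i : 'I_n | P (letter s i) (letter s i.+1) (letter s i.+2)]|.
Proof.
by rewrite wcountE size_word card_set_sum; apply: eq_bigr => i _; rewrite !letterE.
Qed.

Lemma lma_word s : lma s = wlma 0 (word s).
Proof.
rewrite wlmaE size_word /lma card_set_sum; apply: eq_bigr => i _.
rewrite nth_word /=; congr nat_of_bool; apply/forallP/all_takeP => H j.
  rewrite size_word => jn ji; have := H (Ordinal jn); rewrite /= ji /=.
  by rewrite -[j]/(val (Ordinal jn)) nth_word.
by apply/implyP => ji; have := H j; rewrite size_word nth_word => /(_ _ ji); apply.
Qed.

Lemma rma_word s : rma s = wrma (word s) 0.
Proof.
rewrite wrmaE size_word /rma card_set_sum; apply: eq_bigr => i _.
rewrite nth_word andbT; congr nat_of_bool; apply/forallP/all_dropP => H j.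
  rewrite size_word => jn ji; have := H (Ordinal jn); rewrite /= ji /=.
  by rewrite -[j]/(val (Ordinal jn)) nth_word.
by apply/implyP => ji; have := H j; rewrite size_word nth_word => /(_ _ ji); apply.
Qed.

Lemma inv_word s : Defs.inv s = winv (word s).
Proof.
rewrite winvE size_word /Defs.inv -sum1dep_card big_mkcond /=.
rewrite -(pair_bigA _ (fun i j : 'I_n => if (i < j)%N && (s j < s i)%N then 1 else 0)%N) /=.
apply: eq_bigr => i _; rewrite nth_word count_drop size_word.
by apply: eq_bigr => j _; rewrite nth_word /= ltnS; case: ifP.
Qed.

(** The alphabet is listed in decreasing order so that its head is the maximal letter. *)
Lemma perm_words :
  perm_eq [seq word s | s <- enum 'S_n] (permutations (rev (iota 1 n))).
Proof.
have Uw : uniq [seq word s | s <- enum 'S_n].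
  rewrite map_inj_uniq ?enum_uniq // => s t E; apply/permP => i.
  by apply/val_inj/eqP; rewrite -eqSS -!nth_word E.
have Ui : uniq (rev (iota 1 n)) by rewrite rev_uniq iota_uniq.
apply: uniq_perm; rewrite ?permutations_uniq //.
(* Both lists are duplicate-free of length [n] factorial, so one inclusion suffices. *)
refine (uniq_min_size Uw _ _).2; last first.
  rewrite size_permutations // size_rev size_iota size_map.
  by rewrite -cardE card_Sn.
move=> _ /mapP[s _ ->]; rewrite mem_permutations perm_sym.
apply: uniq_perm => //; first by rewrite map_inj_uniq ?enum_uniq // => i j [/val_inj/perm_inj].
move=> k; rewrite mem_rev mem_iota add1n ltnS; apply/andP/mapP.
  case: k => [|k] [] // _ kn; exists ((s^-1)%g (Ordinal kn)); rewrite ?mem_enum //.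
  by rewrite permKV.
by case=> i _ ->.
Qed.
End PermWord.

Lemma Ppoly_words (K : fieldType) n (u1 u2 u3 u4 a b q : K) :
  Ppoly n u1 u2 u3 u4 a b q =
  \sum_(w <- permutations (rev (iota 1 n)))
    (u1 ^+ wcount is_valley 0 w 0 * u2 ^+ (wcount is_peak 0 w 0).-1
     * u3 ^+ wcount is_dasc 0 w 0 * u4 ^+ wcount is_ddes 0 w 0
     * a ^+ (wlma 0 w).-1 * b ^+ (wrma w 0).-1 * q ^+ winv w).
Proof.
rewrite -(perm_big _ (perm_words n)) big_map big_enum.
by apply: eq_bigr => s _; rewrite lma_word rma_word inv_word !wcount_word.
Qed.

Theorem theorem3p1 (K : fieldType) (charK0 : [pchar K] =i pred0)
    (u1 u2 u3 u4 alpha beta q x y : K)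
    (q_neq0 : q != 0) (q_not_root1 : forall n : nat, (0 < n)%N -> q ^+ n != 1)
    (x_neq_y : x != y)
    (xy_sum : x + y = u3 + u4) (xy_prod : x * y = u1 * u2) :
  let F := Fser u1 x y u4 q in
  let Ft := Fser u1 x y u3 q^-1 in
  FPS (fun n => Ppoly n.+1 u1 u2 u3 u4 alpha beta q / qfact q n)
  = fps_exp
      (qint q
         ((1 - q)^-1 *: fps_divz (fps_ln
            (1 - ((1 - q) * alpha) *: (fps_z * (u3%:A + u2 *: fps_dil q F)))^-1))
       + qint q^-1
         ((1 - q^-1)^-1 *: fps_divz (fps_ln
            (1 - ((q - 1) * beta) *: (fps_z * (u4%:A + u2 *: Ft)))^-1))).
Proof.
move=> F Ft.
have F0 : coefs F 0 = 0 := Fser0 _ _ _ _ _.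
have FE : F - fps_dil q F = (1 - q) *: (fps_z *
    (u1%:A + u3 *: F + u4 *: fps_dil q F + u2 *: (F * fps_dil q F))).
  exact: Fser_dil.
have -> : Ft = F by apply: Fser_invq xy_sum.
have c1 c G : coefs (1 - c *: (fps_z * G)) 0 = 1 :> K.
  by rewrite coefsB coefsZ coefs_zM mulr0 subr0.
set U := 1 - _ *: (fps_z * (u3%:A + _)).
set V := 1 - _ *: (fps_z * (u4%:A + _)).
rewrite fps_expD //.
have AE := exp_qint_ln charK0 q_not_root1 (c1 _ _ : coefs U 0 = 1).
have BE := exp_qint_ln charK0 (invq_not_root1 q_not_root1) (c1 _ _ : coefs V 0 = 1).
set hA := qint q _ in AE *; set hB := qint q^-1 _ in BE *.
(* From here on the two exponentials enter only through their dilation equations and constant terms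
   1. *)
clearbody hA hB.
have := coefs0_exp hA; have := coefs0_exp hB.
move: (fps_exp hA) (fps_exp hB) AE BE => A B AE BE B0 A0.
apply/fpsP => n.
have revE : rev (iota 1 n.+1) = n.+1 :: rev (iota 1 n).
  by rewrite -[X in iota 1 X]addn1 iotaD rev_cat add1n.
have pw : pairwise gtn (n.+1 :: rev (iota 1 n)).
  have gtn_trans : transitive gtn by move=> k i j ki jk; apply: ltn_trans jk ki.
  rewrite -revE -sorted_pairwise // rev_sorted; exact: iota_ltn_sorted.
have pos : all (ltn 0) (n.+1 :: rev (iota 1 n)).
  by rewrite -revE all_rev; apply/allP => i; rewrite mem_iota => /andP[].
rewrite [LHS]/= Ppoly_words revE.
rewrite (sum_reduced_weight q_neq0 q_not_root1 F0 FE _ AE _ BE) //.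
- by rewrite size_rev size_iota mulrAC mulfV ?mul1r // qfact_neq0.
Qed.
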